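(* Let $K$ be $\mathbb{R}$ or $\mathbb{C}$. Any linear combination over $K$ of $4\times4$ permutation matrices can be written as a sum of at most $6$ permutative matrices, each of which is a linear combination over $K$ of $4$ permutation matrices that are pairwise $H$-orthogonal.
   Context: A matrix is permutative if each of its rows is a permutation of any other row. A set of nonzero real matrices of the same order is pairwise $H$-orthogonal if the Hadamard (entrywise) product of any two distinct matrices in the set is the zero matrix. *)

(* Defs.v *)
From HB Require Import structures.
From mathcomp Require Import all_boot all_order all_algebra all_fingroup.
From mathcomp Require Import reals complex.

Set Implicit Arguments.
Unset Strict Implicit.
Unset Printing Implicit Defensive.

Import Order.TTheory GRing.Theory Num.Theory.
Local Open Scope ring_scope.

Definition permutative (T : Type) (m n : nat) (A : 'M[T]_(m, n)) : Prop :=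
  forall i j : 'I_m, exists s : 'S_n, row i A = col_perm s (row j A).

Definition hadamard (K : pzRingType) (m n : nat) (A B : 'M[K]_(m, n)) :
    'M[K]_(m, n) :=
  map2_mx *%R A B.

(* [K] may be a complex field, hence the explicit requirement that the entries
   be real; it is vacuous when [K] is a real field. *)
Definition pairwise_Horthogonal (K : numDomainType) (m n : nat)
    (S : {pred 'M[K]_(m, n)}) : Prop :=
  [/\ {in S, forall A, A != 0},
      {in S, forall A, A \is a mxOver Num.real}
    & {in S &, forall A B, A != B -> hadamard A B = 0}].

(* Main.v *)
(* The n rotations of Z/n form a sharply transitive subgroup of the symmetric
   group S_n, so each of its (n-1)! cosets consists of n permutations with
   pairwise disjoint graphs, i.e. of a Latin square; every combination of the
   matrices in one coset is therefore permutative.  Grouping a combination of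
   permutation matrices by cosets uses (n-1)! summands, which is 6 for n = 4.
   The stabilizer of 0, a copy of S_(n-1), serves as a transversal. *)
Require Import Defs.
From HB Require Import structures.
From mathcomp Require Import all_boot all_order all_algebra all_fingroup.
From mathcomp Require Import reals complex.

Set Implicit Arguments.
Unset Strict Implicit.
Unset Printing Implicit Defensive.

Import Order.TTheory GRing.Theory Num.Theory.
Local Open Scope ring_scope.

Definition rot_perm (n : nat) (j : 'I_n.+1) : 'S_n.+1 := perm (addIr j).

(** The left factor acts first, so for fixed [u] these permutations form a right coset of the
    rotation group. *)
Definition coset_perm (n : nat) (p : 'S_n * 'I_n.+1) : 'S_n.+1 :=
  (rot_perm p.2 * lift_perm ord0 ord0 p.1)%g.

Lemma coset_permE (n : nat) (u : 'S_n) (j i : 'I_n.+1) :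
  coset_perm (u, j) i = lift_perm ord0 ord0 u (i + j).
Proof. by rewrite permM [rot_perm _ _]permE. Qed.

Lemma coset_perm_eqr (n : nat) (u : 'S_n) (i j k : 'I_n.+1) :
  (coset_perm (u, j) i == coset_perm (u, k) i) = (j == k).
Proof. by rewrite !coset_permE (inj_eq perm_inj) (inj_eq (addrI i)). Qed.

Lemma coset_perm_inj (n : nat) : injective (@coset_perm n).
Proof.
move=> [u j] [v k] e.
have jk : j = k.
  (* The preimage of 0 determines the rotation: [lift_perm ord0 ord0 u] fixes 0, so that preimage is
     [- j]. *)
  have := coset_permE u j (- j); rewrite e coset_permE addNr lift_perm_id.
  rewrite -[RHS](lift_perm_id ord0 ord0 v) => /perm_inj /eqP.
  by rewrite addrC subr_eq0 => /eqP.
rewrite -{}jk in e *; congr pair; apply/permP => x.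
apply: (@lift_inj n.+1 ord0); rewrite -!(lift_perm_lift ord0 ord0).
by rewrite -[lift ord0 x](subrK j) -!coset_permE e.
Qed.

Lemma coset_perm_bij (n : nat) : bijective (@coset_perm n).
Proof.
apply: inj_card_bij; first exact: coset_perm_inj.
by rewrite card_prod !card_Sn card_ord factS mulnC.
Qed.

Lemma perm_mxE (K : pzSemiRingType) (n : nat) (s : 'S_n) (i j : 'I_n) :
  perm_mx s i j = (s i == j)%:R :> K.
Proof. by rewrite !mxE. Qed.

(** Once the columns are relabelled by the lift of [u], the combination is a circulant matrix: only
    the term [j = k - i] reaches this entry. *)
Lemma coset_perm_combE (K : pzRingType) (n : nat) (u : 'S_n)
    (b : 'I_n.+1 -> K) (i k : 'I_n.+1) :
  (\sum_j b j *: perm_mx (coset_perm (u, j))) i (lift_perm ord0 ord0 u k)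
    = b (k - i).
Proof.
rewrite summxE (bigD1 (k - i)) //= mxE perm_mxE coset_permE.
rewrite [i + _]addrC subrK eqxx mulr1 big1 ?addr0 // => j jNki.
rewrite mxE perm_mxE coset_permE (inj_eq perm_inj) [i + j]addrC.
by rewrite eq_sym -subr_eq eq_sym (negPf jNki) mulr0.
Qed.

Lemma permutative_coset_comb (K : pzRingType) (n : nat) (u : 'S_n)
    (b : 'I_n.+1 -> K) :
  permutative (\sum_j b j *: perm_mx (coset_perm (u, j))).
Proof.
move=> i j; set t := lift_perm ord0 ord0 u.
(* Undo the relabelling of columns, shift circulant row [j] onto row [i], then relabel again. *)
exists (t^-1 * rot_perm (j - i) * t)%g; apply/rowP => k.
rewrite [LHS]mxE !mxE -/t -[k in LHS](permKV t) !permM [rot_perm _ _]permE.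
by rewrite !coset_perm_combE [in RHS]addrA [in RHS]addrAC addrK.
Qed.

Lemma coset_perm_mx_inj (K : nzRingType) (n : nat) (u : 'S_n) :
  injective (fun j => perm_mx (coset_perm (u, j)) : 'M[K]_n.+1).
Proof.
move=> j k /matrixP/(_ 0 (coset_perm (u, j) 0))/eqP.
rewrite !perm_mxE eqxx eq_sym.
have [e _|_] := eqVneq (coset_perm (u, k) 0) (coset_perm (u, j) 0).
  by apply/eqP; rewrite -(coset_perm_eqr u 0) e.
by rewrite eq_sym oner_eq0.
Qed.

Lemma pairwise_Horthogonal_coset (K : numDomainType) (n : nat) (u : 'S_n) :
  pairwise_Horthogonal
    [in codom (fun j => perm_mx (coset_perm (u, j)) : 'M[K]_n.+1)].
Proof.
split=> [_ /codomP[j ->]|_ /codomP[j ->]|_ _ /codomP[j ->] /codomP[k ->]].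
- apply/eqP => /matrixP/(_ 0 (coset_perm (u, j) 0))/eqP.
  by rewrite perm_mxE mxE eqxx oner_eq0.
- by apply/mxOverP => x y; rewrite perm_mxE realn.
- have [-> /eqP //|jk _] := eqVneq j k; apply/matrixP => x y.
  rewrite !mxE -natrM mulnb.
  (* A nonzero product would need both permutations to send [x] to [y], which forces [j = k]. *)
  have [<-|//] := eqVneq (coset_perm (u, j) x) y.
  by rewrite eq_sym coset_perm_eqr (negPf jk).
Qed.

Lemma sum_perm_mx_coset (K : pzRingType) (m n : nat)
    (P : 'I_m -> 'M[K]_n.+1) (a : 'I_m -> K)
    (hP : forall i, is_perm_mx (P i)) :
  exists b : 'S_n -> 'I_n.+1 -> K,
    \sum_i a i *: P i = \sum_u \sum_j b u j *: perm_mx (coset_perm (u, j)).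
Proof.
have /fin_all_exists[s Ps] i : exists s, P i = perm_mx s.
  exact: is_perm_mxP.
(* The [P i] may repeat, so coefficients of equal matrices are added; a permutation that does not
   occur gets the empty sum 0. *)
exists (fun u j => \sum_(i | s i == coset_perm (u, j)) a i).
rewrite pair_big (partition_big s xpredT) //=.
rewrite (reindex (@coset_perm n)) /=; last exact/onW_bij/coset_perm_bij.
apply: eq_bigr => -[u j] _; rewrite scaler_suml.
by apply: eq_bigr => i /eqP <-; rewrite Ps.
Qed.

Theorem proposition3p2 (R : realType) (K : numFieldType)
    (hK : K = (R : numFieldType) \/ K = (R[i] : numFieldType))
    (n : nat) (P : 'I_n -> 'M[K]_4) (a : 'I_n -> K)
    (hP : forall i, is_perm_mx (P i)) :
  exists (k : nat) (B : 'I_k -> 'M[K]_4),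
    [/\ (k <= 6)%N,
        \sum_(i < n) a i *: P i = \sum_(l < k) B l
      & forall l : 'I_k,
          permutative (B l) /\
          exists (Q : 'I_4 -> 'M[K]_4) (b : 'I_4 -> K),
            [/\ injective Q,
                forall j, is_perm_mx (Q j),
                pairwise_Horthogonal [in codom Q]
              & B l = \sum_(j < 4) b j *: Q j]].
Proof.
have [b ->] := sum_perm_mx_coset a hP.
(* One summand per coset, indexed by the transversal ['S_3] of order 3! = 6; some summands may
   vanish. *)
exists #|{: 'S_3}|, (fun l => \sum_j
  b (enum_val l) j *: perm_mx (coset_perm (enum_val l, j))).
split=> [||l]; first by rewrite card_Sn.
- by rewrite (reindex (@enum_val 'S_3 predT)) /=; last exact/onW_bij/enum_val_bij.
split; first exact: permutative_coset_comb.
exists (fun j => perm_mx (coset_perm (enum_val l, j))), (b (enum_val l)).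
split=> //; first exact: coset_perm_mx_inj.
- by move=> j; apply: perm_mx_is_perm.
- exact: pairwise_Horthogonal_coset.
Qed.
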